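(* Let $n\in\mathbb{N}$, $n\ge 1$, and let $\mu\in\mathbb{C}^n$ be generic. Then any 2-local derivation on the (centerless) generalized Virasoro algebra $W_n(\mu)=A_n d_\mu$ is a derivation of the Lie algebra $W_n(\mu)$.
   Context: All algebras are over $\mathbb{C}$. A derivation on a Lie algebra $L$ is a linear map $D:L\to L$ with $D([x,y])=[D(x),y]+[x,D(y)]$ for all $x,y\in L$. A 2-local derivation on $L$ is a map $\Delta:L\to L$ (not necessarily linear) such that for every $x,y\in L$ there exists a derivation $D_{x,y}:L\to L$ with $\Delta(x)=D_{x,y}(x)$ and $\Delta(y)=D_{x,y}(y)$. Let $A_n=\mathbb{C}[t_1^{\pm1},\ldots,t_n^{\pm1}]$, $W_n=\mathrm{Der}(A_n)$ (Lie algebra of $\mathbb{C}$-derivations under the commutator), and $d_i=t_i\frac{\partial}{\partial t_i}$. A vector $\mu=(\mu_1,\ldots,\mu_n)\in\mathbb{C}^n$ is called generic if $\alpha_1\mu_1+\cdots+\alpha_n\mu_n\neq 0$ for all $\alpha\in\mathbb{Z}^n\setminus\{0\}$. For $\mu$ generic put $d_\mu=\mu_1d_1+\cdots+\mu_nd_n$; then $W_n(\mu)=A_nd_\mu=\{f d_\mu: f\in A_n\}$ is a Lie subalgebra of $W_n$, called the (centerless) generalized Virasoro algebra of rank $n$. *)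

(* Defs.v *)
From HB Require Import structures.
From mathcomp Require Import all_boot all_order all_algebra.
From mathcomp Require Import finmap monalg.
From mathcomp Require Import boolp functions reals.
From mathcomp Require Import complex ring.

Set Implicit Arguments.
Unset Strict Implicit.
Unset Printing Implicit Defensive.

Import GRing.Theory.
Local Open Scope ring_scope.

Reserved Notation "[ 'lie' x , y ]" (at level 0, format "[ 'lie'  x ,  y ]").

(* -------------------------------------------------------------------- *)
HB.mixin Record Lmodule_isLieAlgebra (F : fieldType) L of GRing.Lmodule F L := {
  lie : L -> L -> L;
  lie_linearl : forall y : L, linear (lie^~ y);
  lie_linearr : forall x : L, linear (lie x);
  liexx : forall x : L, lie x x = 0;
  lie_jacobi : forall x y z : L,
    lie x (lie y z) + lie y (lie z x) + lie z (lie x y) = 0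
}.

#[short(type="lieAlgType")]
HB.structure Definition LieAlgebra (F : fieldType) :=
  { L of GRing.Lmodule F L & Lmodule_isLieAlgebra F L }.

Notation "[ 'lie' x , y ]" := (lie x y) : ring_scope.

Section LieDerivations.
Context (F : fieldType) (L : lieAlgType F).

Definition lie_derivation (D : L -> L) : Prop :=
  linear D /\ forall x y, D [lie x, y] = [lie D x, y] + [lie x, D y].

Definition two_local_derivation (Delta : L -> L) : Prop :=
  forall x y, exists D : L -> L,
    [/\ lie_derivation D, Delta x = D x & Delta y = D y].

End LieDerivations.

(* -------------------------------------------------------------------- *)
Section AlgebraDerivations.
Context (F : fieldType) (A : comAlgType F).

Definition alg_derivation (D : A -> A) : Prop :=
  linear D /\ forall f g, D (f * g) = D f * g + f * D g.

Definition alg_derivation_pred : {pred A -> A} := fun D => `[< alg_derivation D >].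

Lemma alg_derivationP D : reflect (alg_derivation D) (D \in alg_derivation_pred).
Proof. exact: asboolP. Qed.

Lemma alg_derivation_submod : submod_closed alg_derivation_pred.
Proof.
split=> [|a D E /alg_derivationP[Dl DM] /alg_derivationP[El EM]];
  apply/alg_derivationP; split.
- by move=> c u v /=; rewrite scaler0 addr0.
- by move=> f g /=; rewrite mul0r mulr0 addr0.
- move=> c u v; rewrite /= !fctE Dl El !scalerDr !scalerA addrACA.
  by rewrite (mulrC a c).
- move=> f g; rewrite /= !fctE DM EM scalerDr mulrDl mulrDr addrACA.
  by rewrite -!scalerAl -!scalerAr.
Qed.

HB.instance Definition _ :=
  GRing.isSubmodClosed.Build F (A -> A) alg_derivation_pred
    alg_derivation_submod.

Record alg_der := AlgDer { der_fun :> A -> A; _ : der_fun \in alg_derivation_pred }.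

HB.instance Definition _ := [isSub for der_fun].
HB.instance Definition _ := [Choice of alg_der by <:].
HB.instance Definition _ := [SubChoice_isSubLmodule of alg_der by <:].

Lemma der_funP (D : alg_der) : alg_derivation D.
Proof. exact/alg_derivationP/valP. Qed.

Lemma der_linear (D : alg_der) : linear D.
Proof. by case: (der_funP D). Qed.

HB.instance Definition _ (D : alg_der) :=
  GRing.isLinear.Build F A A _ D (der_linear D).

Lemma derM (D : alg_der) f g : D (f * g) = D f * g + f * D g.
Proof. by case: (der_funP D). Qed.

Lemma derP (D E : alg_der) : D =1 E -> D = E.
Proof. by move=> DE; apply/val_inj/funext. Qed.

Lemma derDE (D E : alg_der) f : (D + E) f = D f + E f.
Proof. by []. Qed.

Lemma derZE c (D : alg_der) f : (c *: D) f = c *: D f.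
Proof. by []. Qed.

Lemma der0E f : (0 : alg_der) f = 0.
Proof. by []. Qed.

Fact der_comm_subproof (D E : alg_der) :
  (fun f => D (E f) - E (D f)) \in alg_derivation_pred.
Proof.
apply/alg_derivationP; split=> [c u v|f g] /=.
  by rewrite !der_linear scalerBr opprD addrACA.
by rewrite !derM !raddfD /= !derM; ring.
Qed.

Definition der_comm (D E : alg_der) : alg_der := AlgDer (der_comm_subproof D E).

Lemma der_comm_linearl E : linear (der_comm^~ E).
Proof.
move=> c D1 D2; apply: derP => f.
change (c *: D1 (E f) + D2 (E f) - E (c *: D1 f + D2 f) =
        c *: (D1 (E f) - E (D1 f)) + (D2 (E f) - E (D2 f))).
by rewrite der_linear scalerBr opprD addrACA.
Qed.

Lemma der_comm_linearr D : linear (der_comm D).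
Proof.
move=> c E1 E2; apply: derP => f.
change (D (c *: E1 f + E2 f) - (c *: E1 (D f) + E2 (D f)) =
        c *: (D (E1 f) - E1 (D f)) + (D (E2 f) - E2 (D f))).
by rewrite der_linear scalerBr opprD addrACA.
Qed.

Lemma der_commxx D : der_comm D D = 0.
Proof. by apply: derP => f /=; rewrite subrr. Qed.

Lemma der_comm_jacobi D1 D2 D3 :
  der_comm D1 (der_comm D2 D3) + der_comm D2 (der_comm D3 D1)
    + der_comm D3 (der_comm D1 D2) = 0.
Proof.
apply: derP => f.
change (D1 (D2 (D3 f) - D3 (D2 f)) - (D2 (D3 (D1 f)) - D3 (D2 (D1 f)))
  + (D2 (D3 (D1 f) - D1 (D3 f)) - (D3 (D1 (D2 f)) - D1 (D3 (D2 f))))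
  + (D3 (D1 (D2 f) - D2 (D1 f)) - (D1 (D2 (D3 f)) - D2 (D1 (D3 f)))) = 0).
by rewrite !raddfB /=; ring.
Qed.

HB.instance Definition _ := Lmodule_isLieAlgebra.Build F alg_der
  der_comm_linearl der_comm_linearr der_commxx der_comm_jacobi.

Lemma der_lieE (D E : alg_der) f : [lie D, E] f = D (E f) - E (D f).
Proof. by []. Qed.

Fact der_mul_subproof (a : A) (D : alg_der) :
  (fun f => a * D f) \in alg_derivation_pred.
Proof.
apply/alg_derivationP; split=> [c u v|f g].
  by rewrite der_linear mulrDr scalerAr.
by rewrite derM; ring.
Qed.

Definition der_mul (a : A) (D : alg_der) : alg_der := AlgDer (der_mul_subproof a D).

Lemma der_mulE a D f : der_mul a D f = a * D f.
Proof. by []. Qed.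

Lemma der_mul_lie f g D :
  [lie der_mul f D, der_mul g D] = der_mul (f * D g - g * D f) D.
Proof. by apply: derP => h; rewrite der_lieE !der_mulE !derM; ring. Qed.

End AlgebraDerivations.

(* -------------------------------------------------------------------- *)
(* The group algebra of K over F: << c *g k >> is c times the group element k,
   and g@_k is the coefficient of k in g.  The product of the library on
   {malg F[K]} is not available here, as it asks for a monoid K without
   non-trivial invertible elements. *)
Definition grpalg (F : fieldType) (K : zmodType) := {malg F[K]}.

HB.instance Definition _ (F : fieldType) (K : zmodType) :=
  GRing.Zmodule.copy (grpalg F K) {malg F[K]}.

(* The scaling of {malg F[K]}, locked because unfolding it makes failing
   convertibility tests diverge. *)
HB.lock Definition ga_scale (F : fieldType) (K : zmodType) (c : F)
    (f : grpalg F K) : grpalg F K := c *: (f : {malg F[K]}).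

Arguments ga_scale {F K} c f.

HB.lock Definition ga_mul (F : fieldType) (K : zmodType) (f g : grpalg F K) :
    grpalg F K :=
  \sum_(k <- msupp f) \sum_(l <- msupp g) << f@_k * g@_l *g k + l >>.

Arguments ga_mul {F K} f g.

Section GroupAlgebra.
Context (F : fieldType) (K : zmodType).
Local Notation A := (grpalg F K).
Implicit Types (f g h : A) (k l : K).

Fact ga_scaleA c1 c2 f : ga_scale c1 (ga_scale c2 f) = ga_scale (c1 * c2) f.
Proof. by rewrite ga_scale.unlock; apply: scalerA. Qed.

Fact ga_scale1 f : ga_scale 1 f = f.
Proof. by rewrite ga_scale.unlock; apply: scale1r. Qed.

Fact ga_scaleDr c f g : ga_scale c (f + g) = ga_scale c f + ga_scale c g.
Proof. by rewrite ga_scale.unlock; apply: scalerDr. Qed.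

Fact ga_scaleDl f c1 c2 : ga_scale (c1 + c2) f = ga_scale c1 f + ga_scale c2 f.
Proof. by rewrite ga_scale.unlock; apply: scalerDl. Qed.

HB.instance Definition _ := GRing.Zmodule_isLmodule.Build F A
  ga_scaleA ga_scale1 ga_scaleDr ga_scaleDl.

Lemma ga_coeffZ (c : F) f k : (c *: f)@_k = c * f@_k.
Proof. by rewrite /GRing.scale /= ga_scale.unlock mcoeffZ. Qed.

Lemma ga_coeffD f g k : (f + g)@_k = f@_k + g@_k.
Proof. exact: (@mcoeffD _ F k f g). Qed.

Lemma ga_scaleU (c a : F) k : c *: (<< a *g k >> : A) = << c * a *g k >>.
Proof. by apply/malgP => l; rewrite ga_coeffZ !mcoeffU mulrnAr. Qed.

Definition ga_one : A := << 1 *g 0 >>.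

Lemma ga_mulw (d1 d2 : {fset K}) f g :
  (msupp f `<=` d1)%fset -> (msupp g `<=` d2)%fset ->
  ga_mul f g = \sum_(k <- d1) \sum_(l <- d2) << f@_k * g@_l *g k + l >>.
Proof.
move=> le_d1 le_d2; rewrite ga_mul.unlock (big_fset_incl _ le_d1) /=.
  apply/eq_bigr=> k1 _; apply/big_fset_incl => // k _ /mcoeff_outdom ->.
  by rewrite mulr0 monalgU0.
move=> k _ /mcoeff_outdom g1k.
by rewrite big1 => // k' _; rewrite g1k mul0r monalgU0.
Qed.

Lemma ga_mulC : commutative (@ga_mul F K).
Proof.
move=> f g; rewrite ga_mul.unlock exchange_big; apply: eq_bigr => k _ /=.
by apply: eq_bigr => l _; rewrite mulrC addrC.
Qed.

Lemma ga_mulUU c1 c2 k1 k2 :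
  ga_mul (<< c1 *g k1 >> : A) << c2 *g k2 >> = << c1 * c2 *g k1 + k2 >>.
Proof. by rewrite (ga_mulw msuppU_le msuppU_le) !big_seq_fset1 !mcoeffUU. Qed.

Lemma ga_mulDl : left_distributive (@ga_mul F K) +%R.
Proof.
move=> f g h.
rewrite (ga_mulw (msuppD_le f g) (fsubset_refl _)).
rewrite (ga_mulw (fsubsetUl (msupp f) (msupp g)) (fsubset_refl _)).
rewrite (ga_mulw (fsubsetUr (msupp f) (msupp g)) (fsubset_refl _)).
rewrite -big_split /=; apply/eq_bigr=> k _.
rewrite -big_split /=; apply/eq_bigr=> l _.
by rewrite mcoeffD mulrDl monalgUD.
Qed.

Lemma ga_mulDr : right_distributive (@ga_mul F K) +%R.
Proof. by move=> f g h; rewrite ga_mulC ga_mulDl !(ga_mulC _ f). Qed.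

Lemma ga_mul0 f : ga_mul 0 f = 0.
Proof. by rewrite ga_mul.unlock msupp0 big_seq_fset0. Qed.

Lemma ga_mul_suml (I : Type) (r : seq I) (E : I -> A) f :
  ga_mul (\sum_(i <- r) E i) f = \sum_(i <- r) ga_mul (E i) f.
Proof. exact: (big_morph (ga_mul^~ f) (fun x y => ga_mulDl x y f) (ga_mul0 f)). Qed.

Lemma ga_mul_sumr (I : Type) (r : seq I) (E : I -> A) f :
  ga_mul f (\sum_(i <- r) E i) = \sum_(i <- r) ga_mul f (E i).
Proof. by rewrite ga_mulC ga_mul_suml; apply: eq_bigr => i _; rewrite ga_mulC. Qed.

Lemma ga_mul1 : left_id ga_one (@ga_mul F K).
Proof.
move=> f; rewrite {1}[f]monalgE ga_mul_sumr [RHS]monalgE.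
by apply: eq_bigr => k _; rewrite ga_mulUU mul1r add0r.
Qed.

Lemma ga_mulEl f g : ga_mul f g = \sum_(k <- msupp f) ga_mul (<< f@_k *g k >> : A) g.
Proof. by rewrite {1}[f]monalgE ga_mul_suml. Qed.

Lemma ga_mulEr f g : ga_mul f g = \sum_(k <- msupp g) ga_mul f (<< g@_k *g k >> : A).
Proof. by rewrite {1}[g]monalgE ga_mul_sumr. Qed.

Lemma ga_mulA : associative (@ga_mul F K).
Proof.
move=> f g h; rewrite (ga_mulEl f (ga_mul g h)) (ga_mulEl f g) [RHS]ga_mul_suml.
apply: eq_bigr => k1 _.
rewrite (ga_mulEl g h) (ga_mulEr _ g) [LHS]ga_mul_sumr [RHS]ga_mul_suml.
apply: eq_bigr => k2 _; rewrite ga_mulUU (ga_mulEr << g@_k2 *g k2 >> h) (ga_mulEr _ h).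
rewrite [LHS]ga_mul_sumr; apply: eq_bigr => k3 _.
by rewrite !ga_mulUU mulrA addrA.
Qed.

Lemma ga_one_neq0 : ga_one != 0.
Proof. by rewrite monalgU_eq0 oner_eq0. Qed.

HB.instance Definition _ := GRing.Zmodule_isComNzRing.Build A
  ga_mulA ga_mulC ga_mul1 ga_mulDl ga_one_neq0.

Lemma ga_scaleAl (c : F) f g : c *: (f * g) = (c *: f) * g.
Proof.
change (c *: ga_mul f g = ga_mul (c *: f) g).
have cE : c *: f = \sum_(k <- msupp f) << c * f@_k *g k >>.
  by rewrite {1}[f]monalgE scaler_sumr; apply: eq_bigr => k _; rewrite ga_scaleU.
rewrite cE (ga_mulEl f g) scaler_sumr [RHS]ga_mul_suml; apply: eq_bigr => k _.
rewrite !(ga_mulEr _ g) scaler_sumr; apply: eq_bigr => l _.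
by rewrite !ga_mulUU ga_scaleU mulrA.
Qed.

HB.instance Definition _ := GRing.Lmodule_isLalgebra.Build F A ga_scaleAl.
HB.instance Definition _ := GRing.Lalgebra_isComAlgebra.Build F A.

Lemma grpalgMUU (c1 c2 : F) k1 k2 :
  (<< c1 *g k1 >> : A) * << c2 *g k2 >> = << c1 * c2 *g k1 + k2 >>.
Proof. exact: ga_mulUU. Qed.

Lemma grpalgE f : f = \sum_(k <- msupp f) (<< f@_k *g k >> : A).
Proof. exact: monalgE. Qed.

Definition ga_weight (phi : K -> F) f : A :=
  \sum_(k <- msupp f) << phi k * f@_k *g k >>.

Lemma ga_coeff_weight phi f k : (ga_weight phi f)@_k = phi k * f@_k.
Proof.
rewrite [in RHS](monalgE f) !raddf_sum mulr_sumr /=.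
apply: eq_bigr => l _; rewrite !mcoeffU.
by case: eqP => [->|_]; rewrite ?mulr1n ?mulr0n ?mulr0.
Qed.

Lemma ga_weightU phi c k : ga_weight phi << c *g k >> = << phi k * c *g k >>.
Proof.
apply/malgP => l; rewrite ga_coeff_weight !mcoeffU.
by case: eqP => [->|_]; rewrite ?mulr1n ?mulr0n ?mulr0.
Qed.

Lemma ga_weight_linear phi : linear (ga_weight phi).
Proof.
move=> c f g; apply/malgP => k.
rewrite ga_coeff_weight !ga_coeffD !ga_coeffZ !ga_coeff_weight.
by rewrite mulrDr mulrCA.
Qed.

HB.instance Definition _ phi :=
  GRing.isLinear.Build F A A _ (ga_weight phi) (ga_weight_linear phi).

Lemma ga_weight_derivation phi :
  {morph phi : k l / k + l} -> alg_derivation (ga_weight phi).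
Proof.
move=> phiD; split=> [|f g]; first exact: ga_weight_linear.
rewrite (grpalgE f) mulr_suml !raddf_sum !mulr_suml -big_split /=.
apply: eq_bigr => k _.
rewrite (grpalgE g) mulr_sumr !raddf_sum !mulr_sumr -big_split /=.
apply: eq_bigr => l _.
rewrite !ga_weightU !grpalgMUU ga_weightU -monalgUD phiD.
by rewrite mulrDl mulrA (mulrCA f@_k).
Qed.

End GroupAlgebra.

(* -------------------------------------------------------------------- *)
(* F[t_1^{+-1}, ..., t_n^{+-1}], where << c *g k >> stands for c t^k. *)
Notation laurent F n := (grpalg F 'rV[int]_n).

(* d/dt_i : t^k |-> k_i t^(k - e_i), where e_i = delta_mx 0 i. *)
HB.lock Definition lpartial (F : fieldType) (n : nat) (i : 'I_n)
    (f : laurent F n) : laurent F n :=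
  \sum_(k <- msupp f) << (k 0 i)%:~R * f@_k *g k - delta_mx 0 i >>.

Arguments lpartial {F n} i f.

Section Laurent.
Context (F : fieldType) (n : nat).
Local Notation A := (laurent F n).

(* t_i. *)
Definition lvar (i : 'I_n) : A := << delta_mx 0 i >>.

(* d_i = t_i d/dt_i. *)
Definition lderi_fun (i : 'I_n) (f : A) : A := lvar i * lpartial i f.

Lemma lderi_funE i : lderi_fun i = @ga_weight F 'rV[int]_n (fun k => (k 0 i)%:~R).
Proof.
apply/funext => f; rewrite /lderi_fun lpartial.unlock mulr_sumr; apply: eq_bigr => k _.
by rewrite grpalgMUU mul1r addrC subrK.
Qed.

Fact lderi_subproof i : lderi_fun i \in @alg_derivation_pred F A.
Proof.
apply/alg_derivationP; rewrite lderi_funE; apply: ga_weight_derivation => k l.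
by rewrite mxE intrD.
Qed.

End Laurent.

(* -------------------------------------------------------------------- *)
Notation witt F n := (alg_der (laurent F n)).

Section GeneralizedVirasoro.
Context (F : fieldType) (n : nat).
Local Notation A := (laurent F n).
Local Notation W := (witt F n).

Definition lderi (i : 'I_n) : W := AlgDer (lderi_subproof F i).

Definition generic (mu : 'rV[F]_n) : Prop :=
  forall alpha : 'rV[int]_n, alpha != 0 ->
    \sum_(i < n) (alpha 0 i)%:~R * mu 0 i != 0.

(* d_mu. *)
Definition lder (mu : 'rV[F]_n) : W := \sum_(i < n) mu 0 i *: lderi i.

Definition gvir_pred (mu : 'rV[F]_n) : {pred W} :=
  fun D => `[< exists f : A, D = der_mul f (lder mu) >].

Lemma gvirP mu D :
  reflect (exists f : A, D = der_mul f (lder mu)) (D \in gvir_pred mu).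
Proof. exact: asboolP. Qed.

Lemma gvir_submod mu : submod_closed (gvir_pred mu).
Proof.
split=> [|c D E /gvirP[f ->] /gvirP[g ->]]; apply/gvirP.
  by exists 0; apply: derP => h; rewrite der_mulE mul0r.
exists (c *: f + g); apply: derP => h.
by rewrite derDE derZE !der_mulE mulrDl scalerAl.
Qed.

Lemma gvir_lie mu D E :
  D \in gvir_pred mu -> E \in gvir_pred mu -> [lie D, E] \in gvir_pred mu.
Proof.
move=> /gvirP[f ->] /gvirP[g ->]; apply/gvirP.
by exists (f * lder mu g - g * lder mu f); rewrite der_mul_lie.
Qed.

Context (mu : 'rV[F]_n).

HB.instance Definition _ :=
  GRing.isSubmodClosed.Build F W (gvir_pred mu) (gvir_submod mu).

(* W_n(mu) = A_n d_mu; it is a Lie subalgebra of W_n for every mu, so genericity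
   is left to the theorems about it. *)
Record gvir := GVir { gvir_val :> W; _ : gvir_val \in gvir_pred mu }.

HB.instance Definition _ := [isSub for gvir_val].
HB.instance Definition _ := [Choice of gvir by <:].
HB.instance Definition _ := [SubChoice_isSubLmodule of gvir by <:].

Definition gvir_bracket (x y : gvir) : gvir :=
  GVir (gvir_lie (valP x) (valP y)).

Lemma gvir_bracket_linearl y : linear (gvir_bracket^~ y).
Proof. by move=> c x1 x2; apply: val_inj; apply: lie_linearl. Qed.

Lemma gvir_bracket_linearr x : linear (gvir_bracket x).
Proof. by move=> c y1 y2; apply: val_inj; apply: lie_linearr. Qed.

Lemma gvir_bracketxx x : gvir_bracket x x = 0.
Proof. by apply: val_inj; apply: liexx. Qed.

Lemma gvir_bracket_jacobi x y z :
  gvir_bracket x (gvir_bracket y z) + gvir_bracket y (gvir_bracket z x)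
    + gvir_bracket z (gvir_bracket x y) = 0.
Proof. by apply: val_inj; apply: lie_jacobi. Qed.

HB.instance Definition _ := Lmodule_isLieAlgebra.Build F gvir
  gvir_bracket_linearl gvir_bracket_linearr gvir_bracketxx gvir_bracket_jacobi.

End GeneralizedVirasoro.

(* Main.v *)
Require Import Defs.
From HB Require Import structures.
From mathcomp Require Import all_boot all_order all_algebra.
From mathcomp Require Import finmap monalg.
From mathcomp Require Import reals complex ring.

Set Implicit Arguments.
Unset Strict Implicit.
Unset Printing Implicit Defensive.

Import GRing.Theory Num.Theory.
Local Open Scope ring_scope.

(** The map f |-> f d_mu identifies W_n(mu) with the Laurent algebra under the
    bracket [f, g] = f d(g) - g d(f), where d multiplies t^k by the weight
    lam k = sum_i k_i mu_i. Genericity of mu says that lam is injective on Z^n. The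
    argument runs in the group algebra of any nonzero abelian group K with an
    injective additive map lam : K -> F to a field of characteristic zero, where
    [t^k, t^l] = (lam l - lam k) t^(k + l).

    Derivations. Since [1, -] = d has the simple spectrum (lam k), a derivation
    that kills 1 is diagonal, t^k |-> phi k t^k, with phi additive. Any
    derivation D becomes one of these after subtracting ad a for a suitable a: this
    asks to solve - d(a) = D(1), hence that D(1) has no constant term, which comes
    from applying D to [1, t^k] = lam k t^k (derivation_decomp).

    2-local derivations. Subtracting from Delta a derivation that agrees with it
    at 1, assume Delta(1) = 0. Comparing x with 1 shows that Delta(x) is obtained
    from x by some additive weight phi_x, and the problem is that phi_x depends on
    x. Let c k be the coefficient by which Delta multiplies t^k. To see that
    Delta multiplies the coefficient of t^l in x by c l (two_local_weight), compare
    x with t^(N l): a derivation agreeing with Delta at t^(N l) is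
    alpha ad t^(N l) + psi with psi additive and N (psi l) = c (N l). The pair t^l,
    t^(N l) shows that c (N l) = N (c l), so psi l = c l; and for suitable N the
    first summand has no effect on the coefficient at l, because x has finite
    support. Thus Delta is the weight map of c; and c is additive, since at
    x = t^k + t^l + t^(k + l) it agrees with phi_x on k, l and k + l
    (two_local_coeff_morph). Hence Delta is a derivation. *)

(** * Additive maps *)

Section AdditiveMorphism.
Context (U V : zmodType) (phi : U -> V).
Hypothesis phiD : {morph phi : k l / k + l}.

Lemma morphD0 : phi 0 = 0.
Proof. by apply: (@addrI _ (phi 0)); rewrite -phiD !addr0. Qed.

Lemma morphDMn N k : phi (k *+ N) = phi k *+ N.
Proof. by elim: N => [|N IHN]; rewrite ?mulr0n ?morphD0 // !mulrS phiD IHN. Qed.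

End AdditiveMorphism.

(** * Derivations of an arbitrary Lie algebra *)

Section LieDerivationTheory.
Context (F : fieldType) (L : lieAlgType F).
Implicit Types (D E Delta : L -> L) (a x y z : L).

HB.instance Definition _ x :=
  GRing.isLinear.Build F L L _ (lie x) (@lie_linearr F L x).

Lemma lieBl z x y : [lie x - y, z] = [lie x, z] - [lie y, z].
Proof. by have := lie_linearl z (-1) y x; rewrite !scaleN1r !(addrC (- _)). Qed.

Lemma lieDl z x y : [lie x + y, z] = [lie x, z] + [lie y, z].
Proof. by have := lie_linearl z 1 x y; rewrite !scale1r. Qed.

Lemma lieC x y : [lie x, y] = - [lie y, x].
Proof.
have := liexx (x - y); rewrite lieBl !raddfB /= !liexx opprK addr0 sub0r => /eqP.
by rewrite -opprD oppr_eq0 addr_eq0 => /eqP.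
Qed.

Lemma lie_derivationB D E :
  lie_derivation D -> lie_derivation E -> lie_derivation (fun x => D x - E x).
Proof.
move=> [Dl DM] [El EM]; split=> [c u v|x y] /=.
  by rewrite Dl El scalerBr opprD addrACA.
by rewrite DM EM lieBl raddfB opprD addrACA.
Qed.

Lemma lie_derivationD D E :
  lie_derivation D -> lie_derivation E -> lie_derivation (fun x => D x + E x).
Proof.
move=> [Dl DM] [El EM]; split=> [c u v|x y] /=.
  by rewrite Dl El scalerDr addrACA.
by rewrite DM EM lieDl raddfD addrACA.
Qed.

Lemma lie_derivation_ad a : lie_derivation (lie a).
Proof.
split=> [|x y]; first exact: lie_linearr.
have := lie_jacobi a x y; rewrite (lieC y a) raddfN /= (lieC y [lie a, x]).
by move=> /eqP; rewrite -addrA -opprD subr_eq0 addrC => /eqP.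
Qed.

Lemma two_local_derivationB Delta D :
  two_local_derivation Delta -> lie_derivation D ->
  two_local_derivation (fun x => Delta x - D x).
Proof.
move=> loc dD x y; have [E [dE Ex Ey]] := loc x y.
exists (fun z => E z - D z); split; first exact: lie_derivationB.
- by rewrite Ex.
- by rewrite Ey.
Qed.

End LieDerivationTheory.

Lemma lie_iso_sym (F : fieldType) (L M : lieAlgType F)
    (f : L -> M) (g : M -> L) :
    linear f -> {morph f : x y / [lie x, y]} -> cancel f g -> cancel g f ->
  linear g /\ {morph g : x y / [lie x, y]}.
Proof.
move=> f_lin fM fK gK; split=> [c x y|x y]; apply: (can_inj fK); first by rewrite f_lin !gK.
by rewrite fM !gK.
Qed.

Lemma lie_derivation_iso (F : fieldType) (L M : lieAlgType F)
    (f : L -> M) (g : M -> L) (D : L -> L) :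
    linear f -> {morph f : x y / [lie x, y]} -> cancel f g -> cancel g f ->
  lie_derivation D -> lie_derivation (fun x => f (D (g x))).
Proof.
move=> f_lin fM fK gK [Dl DM]; have [g_lin gM] := lie_iso_sym f_lin fM fK gK.
split=> [c x y|x y]; first by rewrite g_lin Dl f_lin.
by rewrite gM DM -[f (_ + _)]/(f _) -[X in X + _]scale1r f_lin scale1r !fM !gK.
Qed.

Lemma two_local_derivation_iso (F : fieldType) (L M : lieAlgType F)
    (f : L -> M) (g : M -> L) (Delta : L -> L) :
    linear f -> {morph f : x y / [lie x, y]} -> cancel f g -> cancel g f ->
  two_local_derivation Delta -> two_local_derivation (fun x => f (Delta (g x))).
Proof.
move=> f_lin fM fK gK loc x y; have [D [dD Dx Dy]] := loc (g x) (g y).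
exists (fun z => f (D (g z))); split; first exact: lie_derivation_iso fK gK dD.
- by rewrite Dx.
- by rewrite Dy.
Qed.

(** * The Lie algebra of a weight *)

(** A copy of the group algebra that carries the Lie bracket of the weight lam,
    which has to occur in the type for the Lie structure to be found from it. *)
Definition weight_witt (F : fieldType) (K : zmodType) (lam : {additive K -> F}) :=
  grpalg F K.

Section WeightWittLie.
Context (F : fieldType) (K : zmodType) (lam : {additive K -> F}).
Local Notation A := (grpalg F K).
Local Notation W := (weight_witt lam).

HB.instance Definition _ := GRing.Lmodule.copy W A.

Fact weight_der_subproof : ga_weight lam \in @alg_derivation_pred F A.
Proof. exact/alg_derivationP/ga_weight_derivation/raddfD. Qed.

Definition weight_der : alg_der A := AlgDer weight_der_subproof.

Definition weight_bracket (f g : A) : A := f * weight_der g - g * weight_der f.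

Fact weight_bracket_linearr f : linear (weight_bracket f : W -> W).
Proof.
move=> c g h; rewrite /weight_bracket der_linear mulrDr mulrDl opprD addrACA.
by rewrite -scalerAr -scalerAl -scalerBr.
Qed.

Fact weight_bracket_antisym f g : weight_bracket f g = - weight_bracket g f.
Proof. by rewrite /weight_bracket opprB. Qed.

Fact weight_bracket_linearl g : linear (weight_bracket^~ g : W -> W).
Proof.
move=> c f h; rewrite /= !(weight_bracket_antisym _ g).
by rewrite weight_bracket_linearr opprD scalerN.
Qed.

Fact weight_bracketxx f : weight_bracket f f = 0.
Proof. exact: subrr. Qed.

Fact weight_bracket_jacobi f g h :
  weight_bracket f (weight_bracket g h) + weight_bracket g (weight_bracket h f)
    + weight_bracket h (weight_bracket f g) = 0.
Proof.
rewrite /weight_bracket; move: weight_der => d.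
by rewrite !raddfB /= !derM; ring.
Qed.

HB.instance Definition _ := Lmodule_isLieAlgebra.Build F W
  weight_bracket_linearl weight_bracket_linearr weight_bracketxx
  weight_bracket_jacobi.

Lemma weight_bracketE (f g : W) : [lie f, g] = weight_bracket f g.
Proof. by []. Qed.

Lemma grpalg_coeffUM c k (f : A) m : ((<< c *g k >> : A) * f)@_m = c * f@_(m - k).
Proof.
rewrite [in LHS](grpalgE f) [in RHS](grpalgE f) mulr_sumr !raddf_sum mulr_sumr /=.
apply: eq_bigr => l _; rewrite grpalgMUU !mcoeffU.
by rewrite (eq_sym l) subr_eq (addrC l) eq_sym mulrnAr.
Qed.

Lemma coeff_lieU c k (f : W) m :
  ([lie (<< c *g k >> : W), f] : A)@_m = c * (lam m - lam k *+ 2) * f@_(m - k).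
Proof.
rewrite weight_bracketE /weight_bracket /= ga_weightU (mulrC f).
rewrite (@mcoeffB _ F) !grpalg_coeffUM ga_coeff_weight raddfB /=; ring.
Qed.

End WeightWittLie.

(** * Derivations of the Lie algebra of an injective weight *)

Section WeightWittDerivations.
Context (F : numFieldType) (K : zmodType) (lam : {additive K -> F}).
Hypothesis lam_inj : injective lam.
Local Notation A := (grpalg F K).
Local Notation W := (weight_witt lam).
Local Notation t k := (<< 1 *g k >> : W).
Local Notation "x `_[ k ]" := (mcoeff k (x : A)) (at level 3, format "x `_[ k ]").
Implicit Types (f g a : W) (k l m : K).

Lemma weight_eq0 k : (lam k == 0) = (k == 0).
Proof. by rewrite -(inj_eq lam_inj) raddf0. Qed.

Lemma lieUU (c e : F) k l :
  [lie (<< c *g k >> : W), (<< e *g l >> : W)]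
    = << c * e * (lam l - lam k) *g k + l >>.
Proof.
apply/malgP => m; rewrite coeff_lieU !mcoeffU (eq_sym l) subr_eq (addrC l) eq_sym.
by case: eqP => [<-|_]; rewrite ?mulr0 // raddfD !mulr1n /=; ring.
Qed.

Lemma coeff_lie1 f m : [lie t 0, f]`_[m] = lam m * f`_[m].
Proof. by rewrite coeff_lieU raddf0 mul0rn !subr0 mul1r. Qed.

Lemma coeff_lie_ad1 a m : [lie a, t 0]`_[m] = - (lam m * a`_[m]).
Proof. by rewrite lieC -coeff_lie1; apply: (@mcoeffN _ F). Qed.

(** Applying the derivation to [t^k, t^l] gives additivity where lam k and lam l
    differ. The remaining case k = l follows from it at (k, - k) and
    (k + k, - k). *)
Lemma weight_map_morph (phi : K -> F) :
    phi 0 = 0 -> lie_derivation (ga_weight phi : W -> W) ->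
  {morph phi : k l / k + l}.
Proof.
move=> phi0 [_ phiM].
have phiD k l : k != l -> phi (k + l) = phi k + phi l.
  move=> neq_kl; have := phiM (t k) (t l).
  rewrite lieUU !ga_weightU !lieUU => /(congr1 (mcoeff (k + l))).
  rewrite (@mcoeffD _ F) !mcoeffUU !mulr1 !mul1r -mulrDl.
  by apply: mulIf; rewrite subr_eq0 (inj_eq lam_inj) eq_sym.
move=> k l; have [<-{l}|] := eqVneq k l; last exact: phiD.
have [->|k_neq0] := eqVneq k 0; first by rewrite addr0 phi0 addr0.
have kNk : k != - k.
  rewrite -addr_eq0 -weight_eq0 raddfD -mulr2n mulrn_eq0 /=.
  by rewrite weight_eq0.
have kkNk : k + k != - k.
  rewrite -addr_eq0 -weight_eq0 !raddfD -mulr2n -mulrSr mulrn_eq0 /=.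
  by rewrite weight_eq0.
have := phiD _ _ kNk; rewrite subrr phi0 => /esym/eqP; rewrite addr_eq0 => /eqP phiN.
have := phiD _ _ kkNk; rewrite addrK => phik.
by rewrite [X in _ = X + _]phik phiN; ring.
Qed.

Lemma derivation_weightP (D : W -> W) (phi : K -> F) :
    linear D -> (forall k, D (t k) = << phi k *g k >>) ->
  D =1 (ga_weight phi : W -> W).
Proof.
move=> Dl DU f.
have DZ c u : D (c *: u) = c *: D u := GRing.scalable_linear Dl c u.
have D0 : D 0 = 0 by rewrite -[X in D X](scale0r 0) DZ scale0r.
have DD u v : D (u + v) = D u + D v by have := Dl 1 u v; rewrite !scale1r.
have tE k : (<< f`_[k] *g k >> : W) = f`_[k] *: t k by rewrite (@ga_scaleU F K) mulr1.
rewrite [in LHS](grpalgE f) (big_morph D DD D0); apply: eq_bigr => k _.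
by rewrite [in LHS]tE DZ DU (@ga_scaleU F K) mulrC.
Qed.

(** Such a D commutes with [1, -], which multiplies t^k by lam k; as lam is
    injective, D maps t^k to an eigenvector of the same eigenvalue, that is, to a
    multiple of t^k. *)
Lemma derivation_kill1 (D : W -> W) :
    lie_derivation D -> D (t 0) = 0 ->
  exists phi : K -> F,
    {morph phi : k l / k + l} /\ D =1 (ga_weight phi : W -> W).
Proof.
move=> dD D1; have [Dl DM] := dD.
pose phi k := (D (t k))`_[k].
have DU k : D (t k) = << phi k *g k >>.
  apply/malgP => m; rewrite mcoeffU.
  have [<-|neq_km] := eqVneq k m; first by rewrite mulr1n.
  have := DM (t 0) (t k); rewrite D1 lieUU add0r raddf0 subr0 !mul1r.
  have -> : (<< lam k *g k >> : W) = lam k *: t k by rewrite (@ga_scaleU F K) mulr1.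
  have DZ c u : D (c *: u) = c *: D u := GRing.scalable_linear Dl c u.
  rewrite DZ (lieC 0) raddf0 oppr0 add0r.
  move=> /(congr1 (mcoeff m)); rewrite (@ga_coeffZ F K) coeff_lie1 => /eqP.
  rewrite -subr_eq0 -mulrBl mulf_eq0 subr_eq0 (inj_eq lam_inj) (negPf neq_km) /=.
  by rewrite mulr0n => /eqP.
have DE := derivation_weightP Dl DU.
exists phi; split=> //; apply: weight_map_morph.
  by rewrite /phi D1 mcoeff0.
by have -> : (ga_weight phi : W -> W) = D by apply/boolp.funext => f.
Qed.

Lemma weight_map_derivation (phi : K -> F) :
  {morph phi : k l / k + l} -> lie_derivation (ga_weight phi : W -> W).
Proof.
move=> phiD; have [phi_lin phiM] := ga_weight_derivation phiD.
split=> // f g; rewrite !weight_bracketE /weight_bracket raddfB /= !phiM.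
have comm h : ga_weight phi (ga_weight lam h) = ga_weight lam (ga_weight phi h).
  by apply/malgP => m; rewrite !ga_coeff_weight mulrCA.
by rewrite !comm; ring.
Qed.

Hypothesis K_neq0 : exists k : K, k != 0.

(** In D [1, t^k] = lam k D(t^k), the coefficients at k of [1, D(t^k)] and of
    the right-hand side cancel, which leaves D(1)_0 lam k = 0. Without a nonzero k
    the identity map of the one-dimensional Lie algebra is a counterexample. *)
Lemma derivation1_coeff0 (D : W -> W) : lie_derivation D -> (D (t 0))`_[0] = 0.
Proof.
move=> [Dl DM]; have [k k_neq0] := K_neq0.
have DZ c u : D (c *: u) = c *: D u := GRing.scalable_linear Dl c u.
have := DM (t 0) (t k); rewrite lieUU add0r raddf0 subr0 !mul1r.
have -> : (<< lam k *g k >> : W) = lam k *: t k by rewrite (@ga_scaleU F K) mulr1.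
rewrite DZ (lieC (D _)) => /(congr1 (mcoeff k)).
rewrite (@ga_coeffZ F K) (@ga_coeffD F K) coeff_lie1 (@mcoeffN _ F) coeff_lieU.
rewrite subrr -[X in X = _]add0r => /addIr/esym/eqP.
rewrite oppr_eq0 mulf_eq0 mul1r mulr2n opprD addNKr oppr_eq0 weight_eq0.
by rewrite (negPf k_neq0) => /eqP.
Qed.

(** The diagonal part kills 1, so D(1) = [a, 1] = - d(a), and a is found by
    inverting d on D(1). The normalization of a at 0 makes the decomposition
    unique, since ad 1 is itself the diagonal map of lam. *)
Lemma derivation_decomp (D : W -> W) : lie_derivation D ->
  exists (a : W) (phi : K -> F),
    [/\ a`_[0] = 0, {morph phi : k l / k + l} &
        forall f, D f = [lie a, f] + (ga_weight phi f : W)].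
Proof.
move=> dD; pose a : W := ga_weight (fun k => - (lam k)^-1) (D (t 0)).
have a0 : a`_[0] = 0 by rewrite ga_coeff_weight derivation1_coeff0 // mulr0.
have dDa := lie_derivationB dD (lie_derivation_ad a).
have [|phi [phiD DE]] := derivation_kill1 dDa.
  (* At m = 0 the value 0^-1 = 0 is harmless, as D(1) has no constant term. *)
  apply/malgP => m; rewrite (@mcoeffB _ F) coeff_lie_ad1 ga_coeff_weight mcoeff0.
  have [->|m_neq0] := eqVneq m 0.
    by rewrite derivation1_coeff0 // !mulr0 oppr0 subr0.
  by rewrite mulNr mulrN opprK mulVKf ?weight_eq0 // subrr.
by exists a, phi; split=> // f; rewrite -DE addrC subrK.
Qed.

(** * Two-local derivations for an injective weight *)

Lemma coeff_decomp_diag a (phi : K -> F) k : a`_[0] = 0 ->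
  ([lie a, t k] + (ga_weight phi (t k) : W))`_[k] = phi k.
Proof.
move=> a0; rewrite (@ga_coeffD F K) lieC (@mcoeffN _ F) coeff_lieU subrr a0.
by rewrite mulr0 oppr0 add0r ga_weightU mcoeffUU mulr1.
Qed.

(** A derivation acting on t^k as a scalar has inner part alpha ad t^k only:
    for m nonzero, ad t^m moves t^k, by a nonzero factor unless m = k. *)
Lemma ad_mono_diag a k : a`_[0] = 0 ->
    (forall m, m != k -> [lie a, t k]`_[m] = 0) ->
  a = << a`_[k] *g k >>.
Proof.
move=> a0 ak; apply/malgP => m; rewrite mcoeffU.
have [<-|km] := eqVneq k m; first by rewrite mulr1n.
rewrite mulr0n; have [->//|m_neq0] := eqVneq m 0.
have /ak/eqP : m + k != k by rewrite -subr_eq0 addrK.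
rewrite lieC (@mcoeffN _ F) coeff_lieU addrK oppr_eq0 mul1r mulf_eq0.
rewrite raddfD mulr2n opprD addrA /= addrK subr_eq0 (inj_eq lam_inj) eq_sym.
by rewrite (negPf km) => /eqP.
Qed.

(** The elements l - N l are pairwise distinct, because lam embeds K into a
    field of characteristic zero. *)
Lemma exists_mulrn_shift_notin (S : {fset K}) l : l != 0 ->
  exists2 N : nat, N != 0%N & l - l *+ N \notin S.
Proof.
move=> l_neq0.
have [/allP all_in|/allPn[_ /mapP[N + ->] notinS]] :=
  boolP (all (mem S) [seq l - l *+ N | N <- iota 1 #|` S|.+1]).
- suff /uniq_leq_size/(_ all_in) : uniq [seq l - l *+ N | N <- iota 1 #|` S|.+1].
    by rewrite size_map size_iota ltnn.
  rewrite map_inj_uniq ?iota_uniq // => M N /addrI/oppr_inj/(congr1 lam).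
  rewrite !raddfMn /= => /(mulrIn _); apply.
  by rewrite weight_eq0.
- by rewrite mem_iota => /andP[N_gt0 _]; exists N => //; rewrite -lt0n.
Qed.

Section Normalized.
Variable Delta : W -> W.
Hypotheses (Delta_loc : two_local_derivation Delta) (Delta1 : Delta (t 0) = 0).
Let c k : F := (Delta (t k))`_[k].

Lemma two_local_pointwise f : exists phi : K -> F,
  {morph phi : k l / k + l} /\ forall m, (Delta f)`_[m] = phi m * f`_[m].
Proof.
have [D [dD D1 Df]] := Delta_loc (t 0) f.
have [|phi [phiD DE]] := derivation_kill1 dD; first by rewrite -D1.
by exists phi; split=> // m; rewrite Df DE ga_coeff_weight.
Qed.

Lemma two_local_mono k : Delta (t k) = << c k *g k >>.
Proof.
have [phi [_ phiE]] := two_local_pointwise (t k).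
apply/malgP => m; rewrite mcoeffU; case: eqP => [<-|/eqP/negPf km] //.
by rewrite phiE mcoeffU km mulr0.
Qed.

(** Additivity of c is not visible on pairs of monomials in independent
    directions; a single pair only gives it along the multiples of k. *)
Lemma two_local_coeff_muln k N : c (k *+ N) = c k *+ N.
Proof.
have [D [/derivation_decomp[a [phi [a0 phiD DE]]] Dk DkN]] :=
  Delta_loc (t k) (t (k *+ N)).
rewrite /c Dk DkN !DE !coeff_decomp_diag //.
exact: morphDMn.
Qed.

(** The comparison of f with t^(N l): ad t^(N l) carries the coefficient of f at
    l - N l to the coefficient at l, and N is chosen to make the former vanish. *)
Lemma two_local_weight f : Delta f = ga_weight c f.
Proof.
apply/malgP => l; rewrite ga_coeff_weight.
have [phi [phiD phiE]] := two_local_pointwise f.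
have [->|l_neq0] := eqVneq l 0.
  by rewrite phiE (morphD0 phiD) /c Delta1 mcoeff0 !mul0r.
have [N N_neq0 lN_notin] := exists_mulrn_shift_notin (msupp f) l_neq0.
have [D [/derivation_decomp[a [psi [a0 psiD DE]]] DlN Df]] :=
  Delta_loc (t (l *+ N)) f.
have aE : a = << a`_[l *+ N] *g l *+ N >>.
  apply: ad_mono_diag => // m m_neq.
  have := congr1 (mcoeff m) DlN; rewrite DE two_local_mono (@ga_coeffD F K).
  by rewrite ga_weightU !mcoeffU eq_sym (negPf m_neq) !mulr0n addr0.
have <- : psi l = c l.
  have := two_local_coeff_muln l N.
  rewrite /c DlN DE coeff_decomp_diag // (morphDMn psiD) -/(c l).
  by rewrite -[psi l *+ N]mulr_natr -[c l *+ N]mulr_natr; apply: mulIf; rewrite pnatr_eq0.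
rewrite Df DE (@ga_coeffD F K) ga_coeff_weight aE coeff_lieU.
by rewrite (mcoeff_outdom lN_notin) mulr0 add0r.
Qed.

(** One element whose support contains k, l and k + l turns the additivity of
    its own weight into additivity of c. *)
Lemma two_local_coeff_morph : {morph c : k l / k + l}.
Proof.
move=> k l; pose f : W := t k + t l + t (k + l).
have f_neq0 m : m \in [:: k; l; k + l] -> f`_[m] != 0.
  (* If some of k, l, k + l coincide, the coefficients add up to 2 or 3. *)
  rewrite !inE /f !(@ga_coeffD F K) !mcoeffU !(eq_sym m) -!mulrnDr.
  by rewrite pnatr_eq0; do 3![case: eqP].
have [phi [phiD phiE]] := two_local_pointwise f.
have cE m : m \in [:: k; l; k + l] -> c m = phi m.
  move=> /f_neq0 fm; apply: (mulIf fm).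
  by rewrite -phiE two_local_weight ga_coeff_weight.
by rewrite !cE ?inE ?eqxx ?orbT.
Qed.

End Normalized.

Theorem two_local_derivation_weight_witt (Delta : W -> W) :
  two_local_derivation Delta -> lie_derivation Delta.
Proof.
move=> loc; have [D0 [dD0 D01 _]] := loc (t 0) (t 0).
pose Delta' f := Delta f - D0 f.
have loc' : two_local_derivation Delta' by exact: two_local_derivationB.
have Delta'1 : Delta' (t 0) = 0 by rewrite /Delta' D01 subrr.
pose c k := (Delta' (t k))`_[k].
have dw := weight_map_derivation (two_local_coeff_morph loc' Delta'1).
have -> : Delta = fun f => (ga_weight c f : W) + D0 f.
  apply/boolp.funext => f.
  by rewrite -(two_local_weight loc' Delta'1) /Delta' subrK.
exact: lie_derivationD.
Qed.

End WeightWittDerivations.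

(** * The generalized Virasoro algebra *)

Section GenericWeight.
Context (F : numFieldType) (n : nat) (mu : 'rV[F]_n).
Local Notation A := (laurent F n).

Definition pairing (k : 'rV[int]_n) : F := \sum_(i < n) (k 0 i)%:~R * mu 0 i.

Fact pairing_is_additive : zmod_morphism pairing.
Proof.
move=> k l; rewrite /pairing -sumrB; apply: eq_bigr => i _.
by rewrite !mxE intrB mulrBl.
Qed.

HB.instance Definition _ :=
  GRing.isZmodMorphism.Build 'rV[int]_n F pairing pairing_is_additive.

Lemma generic_pairing_inj : generic mu -> injective pairing.
Proof.
move=> gen k l /eqP; rewrite -subr_eq0 -raddfB => /eqP kl0.
by apply/eqP; rewrite -subr_eq0; apply: contraPT kl0 => /gen/eqP.
Qed.

Lemma lder_weight : lder mu = weight_der pairing.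
Proof.
apply: derP => f; apply/malgP => k.
rewrite [RHS]ga_coeff_weight /lder /pairing mulr_suml.
pose coef (D : witt F n) := (D f)@_k.
have coef0 : coef 0 = 0 by exact: mcoeff0.
have coefD D E : coef (D + E) = coef D + coef E by exact: ga_coeffD.
rewrite -/(coef _) (big_morph coef coefD coef0); apply: eq_bigr => i _.
rewrite /coef derZE ga_coeffZ /= lderi_funE ga_coeff_weight.
by rewrite mulrA (mulrC (mu 0 i)).
Qed.

Local Notation W := (weight_witt pairing).

Fact gvir_of_subproof (f : W) : der_mul (f : A) (lder mu) \in gvir_pred mu.
Proof. by apply/gvirP; exists f. Qed.

Definition gvir_of (f : W) : gvir mu := GVir (gvir_of_subproof f).

(** The inverse of gvir_of when k has nonzero weight: the derivation f d_mu maps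
    t^k to lam k f t^k, from which f is recovered. *)
Definition gvir_coef (k : 'rV[int]_n) (x : gvir mu) : W :=
  (pairing k)^-1 *: ((<< 1 *g - k >> : A) * gvir_val x (<< 1 *g k >> : A)).

Lemma gvir_of_linear : linear gvir_of.
Proof.
move=> c f g; apply: val_inj; apply: derP => h /=.
by rewrite -[RHS]/(c *: (f * lder mu h) + g * lder mu h) mulrDl scalerAl.
Qed.

Lemma gvir_of_lie : {morph gvir_of : f g / [lie f, g]}.
Proof.
move=> f g; apply: val_inj.
rewrite -[RHS]/([lie der_mul (f : A) (lder mu), der_mul (g : A) (lder mu)]).
by rewrite der_mul_lie weight_bracketE /weight_bracket -lder_weight.
Qed.

Lemma gvir_ofK k : pairing k != 0 -> cancel gvir_of (gvir_coef k).
Proof.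
move=> k_neq0 f; rewrite /gvir_coef /= lder_weight /= ga_weightU mulr1.
rewrite mulrCA grpalgMUU mul1r addNr.
have -> : << pairing k *g 0 >> = pairing k *: (1 : A) by rewrite [RHS]ga_scaleU mulr1.
by rewrite -scalerAr mulr1 scalerA mulVf // scale1r.
Qed.

Lemma gvir_coefK k : pairing k != 0 -> cancel (gvir_coef k) gvir_of.
Proof.
move=> k_neq0 x; have /gvirP[f fE] := valP x.
have -> : x = gvir_of f by apply: val_inj.
by rewrite gvir_ofK.
Qed.

End GenericWeight.

Theorem corollary3p5 (R : realType) (n : nat) (mu : 'rV[R[i]]_n) :
  (1 <= n)%N -> generic mu ->
  forall Delta : gvir mu -> gvir mu,
    two_local_derivation Delta -> lie_derivation Delta.
Proof.
move=> n_gt0 gen Delta loc.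
have lam_inj := generic_pairing_inj gen.
pose k : 'rV[int]_n := delta_mx 0 (Ordinal n_gt0).
have k_neq0 : k != 0 by apply/eqP => /matrixP/(_ 0 (Ordinal n_gt0)); rewrite !mxE !eqxx.
have lamk : pairing mu k != 0 by rewrite weight_eq0.
have ofK := gvir_ofK lamk; have coefK := gvir_coefK lamk.
have [coef_lin coefM] := lie_iso_sym (@gvir_of_linear _ _ mu) (@gvir_of_lie _ _ mu) ofK coefK.
have loc' := two_local_derivation_iso coef_lin coefM coefK ofK loc.
have der' := two_local_derivation_weight_witt lam_inj (ex_intro _ k k_neq0) loc'.
have := lie_derivation_iso (@gvir_of_linear _ _ mu) (@gvir_of_lie _ _ mu) ofK coefK der'.
by have -> : (fun x => gvir_of (gvir_coef k (Delta (gvir_of (gvir_coef k x))))) = Delta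
  by apply/boolp.funext => x; rewrite !coefK.
Qed.
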